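(* Let $C$ be the cost Hamiltonian of a cost function $c:\{0,1\}^n\to\mathbb{R}$, and let $\gamma,\beta\in\mathbb{R}$. For QAOA$_1$ the cost expectation is $$\langle C\rangle_1=\langle C\rangle_0-\gamma\beta\,\langle\nabla_C\nabla C\rangle_0+\sum_{\substack{\ell,k\ge1\\ \ell+k\ge4,\ \ell+k\text{ even}}}\frac{(i\gamma)^\ell(i\beta)^k}{\ell!\,k!}\,\langle\nabla_C^\ell\nabla^kC\rangle_0,$$ where $\langle\nabla_C\nabla C\rangle_0=\frac{2}{2^n}\sum_xc(x)\,dc(x)\le0$, and for each $x\in\{0,1\}^n$ the probability of measuring $x$ is $$P_1(x)=P_0(x)+\sum_{\substack{\ell,k\ge1\\ \ell+k\text{ even}}}\frac{(i\gamma)^\ell(i\beta)^k}{\ell!\,k!}\,\langle\nabla_C^\ell\nabla^kH_x\rangle_0,$$ where $H_x=|x\rangle\langle x|$ and $P_0(x)=2^{-n}$.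
   Context: Work on $n$ qubits with computational basis $\{|x\rangle : x\in\{0,1\}^n\}$. The cost Hamiltonian is $C=\sum_x c(x)|x\rangle\langle x|$, the mixing Hamiltonian is $B=\sum_{j=1}^nX_j$, and $|s\rangle=2^{-n/2}\sum_x|x\rangle$. The superoperators are $\nabla A=[B,A]$ and $\nabla_CA=[C,A]$; powers denote iteration, so $\nabla_C^\ell\nabla^kA$ means apply $[B,\cdot]$ $k$ times and then $[C,\cdot]$ $\ell$ times. $\langle A\rangle_0=\langle s|A|s\rangle$. The QAOA$_1$ state is $|\gamma\beta\rangle=e^{-i\beta B}e^{-i\gamma C}|s\rangle$, $P_1(x)=|\langle x|\gamma\beta\rangle|^2$ and $\langle C\rangle_1=\langle\gamma\beta|C|\gamma\beta\rangle$. With $x^{(j)}$ denoting $x$ with its $j$th bit flipped, $dc(x)=\sum_{j=1}^n\big(c(x^{(j)})-c(x)\big)$. *)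

(* Defs.v *)
(* The complex numbers are R[i], for R : realType the real numbers. *)
From mathcomp Require Import all_boot all_order all_algebra.
From mathcomp Require Import sesquilinear spectral complex.
From mathcomp Require Import boolp classical_sets functions cardinality fsbigop.
From mathcomp Require Import reals topology normedtype sequences esum.

Set Implicit Arguments.
Unset Strict Implicit.
Unset Printing Implicit Defensive.

Import Order.TTheory GRing.Theory Num.Theory.
Import numFieldNormedType.Exports.

Local Open Scope classical_set_scope.
Local Open Scope complex_scope.
Local Open Scope sesquilinear_scope.
Local Open Scope ring_scope.

(* [R[i]^o] is R[i] with the topology of its (complex-valued) norm. *)
Definition expmx (R : realType) (m : nat) (A : 'M[R[i]]_m) : 'M[R[i]]_m :=
  \matrix_(a, b)
    lim ((fun N : nat =>
            (\sum_(k < N) (k`!%:R : R[i])^-1 *: A ^+ k) a b : R[i]^o) @ \oo).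

(* Unconditional summation: the finite partial sums of the family [f] over [D]
   converge to [s] along the finite subsets of [D] directed by inclusion. *)
Definition has_sum (R : realType) (I : choiceType) (D : set I) (f : I -> R[i])
    (s : R[i]) : Prop :=
  forall e : R, 0 < e ->
    exists2 A : set I, fsets D A &
      forall F : set I, fsets D F -> A `<=` F ->
        `|\sum_(p \in F) f p - s| < e%:C.

Definition commutator (R : realType) (m : nat) (A M : 'M[R[i]]_m) : 'M[R[i]]_m :=
  A *m M - M *m A.

Definition bits (n : nat) : finType := {ffun 'I_n -> bool}.

Definition flip (n : nat) (x : bits n) (j : 'I_n) : bits n :=
  [ffun k => if k == j then ~~ x k else x k].

(* The Hilbert space of n qubits is the space of columns of height #|bits n|;
   the bit string x labels the basis vector of index [enum_rank x]. *)
Definition dimq (n : nat) : nat := #|bits n|.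

Section Qubits.
Variables (R : realType) (n : nat).

Definition ket (x : bits n) : 'cV[R[i]]_(dimq n) := delta_mx (enum_rank x) 0.

Definition proj (x : bits n) : 'M[R[i]]_(dimq n) := ket x *m (ket x)^t*.

Definition plus_state : 'cV[R[i]]_(dimq n) :=
  (Num.sqrt 2 ^- n : R)%:C *: \sum_(x : bits n) ket x.

Definition pauliX (j : 'I_n) : 'M[R[i]]_(dimq n) :=
  \sum_(x : bits n) ket (flip x j) *m (ket x)^t*.

Definition mixer : 'M[R[i]]_(dimq n) := \sum_(j < n) pauliX j.

Definition costH (c : bits n -> R) : 'M[R[i]]_(dimq n) :=
  \sum_(x : bits n) (c x)%:C *: proj x.

Definition nabla : 'M[R[i]]_(dimq n) -> 'M[R[i]]_(dimq n) := commutator mixer.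

Definition nablaC (c : bits n -> R) : 'M[R[i]]_(dimq n) -> 'M[R[i]]_(dimq n) :=
  commutator (costH c).

Definition expect (psi : 'cV[R[i]]_(dimq n)) (A : 'M[R[i]]_(dimq n)) : R[i] :=
  (psi^t* *m A *m psi) 0 0.

Definition expect0 (A : 'M[R[i]]_(dimq n)) : R[i] := expect plus_state A.

Definition prob (psi : 'cV[R[i]]_(dimq n)) (x : bits n) : R[i] :=
  `|((ket x)^t* *m psi) 0 0| ^+ 2.

Definition qaoa1 (c : bits n -> R) (gamma beta : R) : 'cV[R[i]]_(dimq n) :=
  expmx (- ('i%C * beta%:C) *: mixer) *m
  (expmx (- ('i%C * gamma%:C) *: costH c) *m plus_state).

Definition dcost (c : bits n -> R) (x : bits n) : R :=
  \sum_(j < n) (c (flip x j) - c x).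

Definition series_term (c : bits n -> R) (gamma beta : R)
    (A : 'M[R[i]]_(dimq n)) (p : nat * nat) : R[i] :=
  ('i%C * gamma%:C) ^+ p.1 * ('i%C * beta%:C) ^+ p.2 / (p.1`! * p.2`!)%:R
  * expect0 (iter p.1 (nablaC c) (iter p.2 nabla A)).

End Qubits.

Arguments mixer R n : clear implicits.
Arguments plus_state R n : clear implicits.

(* Main.v *)
(* For real symmetric H with spectral projections P_a and eigenvalues l_a,
     (ad_H)^k M    = sum_(a, b) (l_a - l_b)^k P_a M P_b   and
     e^(itH) M e^(-itH) = sum_(a, b) e^(it (l_a - l_b)) P_a M P_b.
   Applied to B and then to C, this turns the double series of nested commutators
   into a finite linear combination of products of two scalar exponential series,
   which sums absolutely to the evolved expectation.  The terms with k > 0 = l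
   vanish because |s> is an eigenvector of B, those with l > 0 = k because C
   commutes with the observable, and those with l + k odd because the nested
   commutator is then a real antisymmetric matrix while |s> is real. *)
Require Import Defs.
From mathcomp Require Import all_boot all_order all_algebra.
From mathcomp Require Import sesquilinear spectral complex ring finmap.
From mathcomp Require Import boolp classical_sets functions cardinality fsbigop.
From mathcomp Require Import reals topology normedtype sequences trigo esum.

Set Implicit Arguments.
Unset Strict Implicit.
Unset Printing Implicit Defensive.

Import Order.TTheory GRing.Theory Num.Theory.
Import numFieldNormedType.Exports.

Local Open Scope classical_set_scope.
Local Open Scope complex_scope.
Local Open Scope sesquilinear_scope.
Local Open Scope ring_scope.

(** * The imaginary exponential series and its convergence *)

Section Analysis.
Variable R : realType.
Local Notation C := R[i].

(** This is e^(it); in this form the real cosine and sine series give its power series. *)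
Definition cis (t : R) : C := cos t +i* sin t.

Lemma cisD s t : cis (s + t) = cis s * cis t.
Proof. by apply/eqP; rewrite eq_complex/= cosD sinD (addrC (sin s * _)) !eqxx. Qed.

Lemma conj_cis t : (cis t)^*%C = cis (- t).
Proof. by rewrite /cis cosN sinN. Qed.

Lemma norm_complex_le (z : C) : `|z| <= (`|complex.Re z| + `|complex.Im z|)%:C.
Proof.
rewrite {1}(complexE z) (le_trans (ler_normD _ _))// normrM.
rewrite !normc_def/= !expr0n/= expr1n !addr0 add0r !sqrtr_sqr sqrtr1 mul1r.
by rewrite rmorphD.
Qed.

Lemma cvg_complex (u v : R^nat) (a b : R) :
  u @ \oo --> a -> v @ \oo --> b ->
  (fun N => (u N +i* v N) : C^o) @ \oo --> ((a +i* b) : C^o).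
Proof.
move=> ua vb; apply/cvgrPdist_lt => e e0.
(* The radius [e] lives in R[i]; being positive it is real, so each component can be given half of
   its real part. *)
have er : e = (complex.Re e)%:C by rewrite RRe_real// gtr0_real.
have re0 : 0 < complex.Re e / 2 by rewrite divr_gt0// -ltcR -er.
move/cvgrPdist_lt/(_ _ re0) : ua => ua.
move/cvgrPdist_lt/(_ _ re0) : vb => vb.
near=> N.
apply: le_lt_trans (norm_complex_le _) _.
rewrite er ltcR/= [ltRHS]splitr ltrD//; [by near: N|by near: N].
Unshelve. all: by end_near. Qed.

Definition iexp_coeff (t : R) (k : nat) : C := ('i%C * t%:C) ^+ k / k`!%:R.

Lemma natrC (m : nat) : m%:R = (m%:R : R)%:C :> C.
Proof. by rewrite rmorph_nat. Qed.

(** Even powers of i are real and carry the cosine coefficients, odd powers are imaginary and carry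
    the sine coefficients. *)
Lemma iexp_coeffE t k : iexp_coeff t k = cos_coeff t k +i* sin_coeff t k.
Proof.
have cosE : cos_coeff t k = (~~ odd k)%:R * (-1) ^+ k./2 * t ^+ k / k`!%:R.
  by [].
have sinE : sin_coeff t k = (odd k)%:R * (-1) ^+ k.-1./2 * t ^+ k / k`!%:R.
  by [].
rewrite /iexp_coeff exprMn.
have -> : 'i%C ^+ k = ((~~ odd k)%:R * (-1) ^+ k./2) +i*
                      ((odd k)%:R * (-1) ^+ k.-1./2) :> C.
  rewrite -{1}(odd_double_half k) exprD -mul2n exprM sqr_i.
  have -> : (-1) ^+ k./2 = ((-1) ^+ k./2 : R)%:C :> C by rewrite rmorphXn/= rmorphN1.
  clear cosE sinE; case: k => [|k]; first by rewrite /=; simpc.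
  by rewrite /= uphalf_half; case: (boolP (odd k)) => ok/=; simpc.
rewrite natrC -rmorphXn -fmorphV/= cosE sinE.
by simpc.
Qed.

Lemma cvg_iexp t :
  (fun N => \sum_(k < N) iexp_coeff t k : C^o) @ \oo --> (cis t : C^o).
Proof.
have -> : (fun N => \sum_(k < N) iexp_coeff t k : C^o) =
    (fun N => series (cos_coeff t) N +i* series (sin_coeff t) N).
  apply/funext => N; rewrite /series/= !big_mkord.
  elim: N => [|N IH]; first by rewrite !big_ord0.
  by rewrite !big_ord_recr/= IH iexp_coeffE; simpc.
have ccos : series (cos_coeff t) @ \oo --> cos t.
  by rewrite unlock; exact: is_cvg_series_cos_coeff.
have csin : series (sin_coeff t) @ \oo --> sin t.
  by rewrite unlock; exact: is_cvg_series_sin_coeff.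
exact: cvg_complex.
Qed.

(** This makes the convergent series of e^|t| a majorant of the series of e^(it). *)
Lemma norm_iexp_coeff t k : `|iexp_coeff t k| = (exp_coeff `|t| k)%:C.
Proof.
rewrite /iexp_coeff /exp_coeff/= normrM normrX normrM normfV.
rewrite !normc_def/= !expr0n/= expr1n addr0 add0r sqrtr1 mul1r sqrtr_sqr.
rewrite natrC expr0n addr0 sqrtr_sqr normr_nat.
by rewrite -rmorphXn -fmorphV -rmorphM.
Qed.

(** * Unconditional summation of double series *)

Lemma fsbig_setD (V : zmodType) (I : choiceType) (A B : set I) (h : I -> V) :
  finite_set B -> A `<=` B ->
  \sum_(p \in B) h p - \sum_(p \in A) h p = \sum_(p \in B `\` A) h p.
Proof.
move=> finB AB; rewrite (fsbigID A)//= setIidr//.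
by rewrite [X in X - _]addrC addrK.
Qed.

(** Once a square of indices leaves a small tail of the majorant [g], any finite set containing that
    square changes the sum of [f] by at most that tail. *)
Lemma has_sum_squares (f : nat * nat -> C) (g : nat * nat -> R) (s : C) (t : R) :
  (forall p, `|f p| <= (g p)%:C) ->
  (fun N => \sum_(l < N) \sum_(k < N) f (l : nat, k : nat) : C^o) @ \oo
    --> (s : C^o) ->
  (fun N => \sum_(l < N) \sum_(k < N) g (l : nat, k : nat)) @ \oo --> t ->
  has_sum setT f s.
Proof.
move=> fg fs gt; pose sq N : set (nat * nat) := `I_N `*` `I_N.
have fin_sq N : finite_set (sq N) by exact: finite_setX.
have sqE (V : zmodType) (h : nat * nat -> V) N :
    \sum_(l < N) \sum_(k < N) h (l : nat, k : nat) = \sum_(p \in sq N) h p.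
  have -> : \sum_(p \in sq N) h p = \sum_(p \in sq N) h (p.1, p.2).
    by apply: eq_fsbigr; case.
  rewrite -(@pair_fsbig _ _ _ _ _ _ _ (fun l k => h (l, k)))//.
  rewrite -fsbig_ord; apply: eq_bigr => l _.
  by rewrite -(@fsbig_ord _ _ _ _ (fun k => h (l : nat, k))).
have g0 p : 0 <= g p by rewrite -ler0c (le_trans _ (fg p)).
have sq_sub N M : (N <= M)%N -> sq N `<=` sq M.
  by move=> NM [a b] [/= aN bN]; split => /=; exact: leq_trans NM.
have g_le A B : finite_set B -> A `<=` B ->
    \sum_(p \in A) g p <= \sum_(p \in B) g p.
  by move=> finB AB; rewrite -subr_ge0 fsbig_setD// fsumr_ge0.
(* The terms of [g] are nonnegative, so its square sums increase and stay below their limit. *)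
have g_let N : \sum_(p \in sq N) g p <= t.
  rewrite -(cvg_lim _ gt)// -sqE.
  apply: (@nondecreasing_cvgn_le _
    (fun N => \sum_(l < N) \sum_(k < N) g (l : nat, k : nat))).
    by move=> a b ab; rewrite !sqE g_le//; exact: sq_sub.
  by apply/cvg_ex; exists t.
move=> e e0; have e2 : 0 < e / 2 by rewrite divr_gt0.
have e2c : 0 < (e / 2)%:C :> C by rewrite ltcR.
move/cvgrPdist_lt/(_ _ e2c) : fs => fs.
move/cvgrPdist_lt/(_ _ e2) : gt => gt.
have [N [fsN gtN]] : exists N,
    `|s - \sum_(p \in sq N) f p| < (e / 2)%:C /\
    `|t - \sum_(p \in sq N) g p| < e / 2.
  near \oo => N; exists N; rewrite -!sqE; split; by near: N.
exists (sq N); first by split.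
move=> F [finF _] sqF.
have [M FM] : exists M, F `<=` sq M.
  exists (\max_(p <- fset_set F) (maxn p.1 p.2)).+1 => p Fp.
  have pF : p \in fset_set F by rewrite in_fset_set//; exact: mem_set.
  have := @leq_bigmax_seq _ (enum_fset (fset_set F)) xpredT
    (fun q => maxn q.1 q.2) p pF isT.
  by rewrite geq_max => /andP[]; split.
(* The error splits into the part of [F] outside the square and the error of the square itself, each
   worth half of [e]. *)
have -> : \sum_(p \in F) f p - s =
    \sum_(p \in F `\` sq N) f p - (s - \sum_(p \in sq N) f p).
  by rewrite -fsbig_setD// opprB addrA subrK.
rewrite (le_lt_trans (ler_normB _ _))// [e]splitr rmorphD/= ler_ltD//.
have -> : (\sum_(p \in F `\` sq N) f p) = \sum_(p <- fset_set (F `\` sq N)) f p.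
  by rewrite fsbig_finite//; exact: finite_setD.
apply: le_trans (ler_norm_sum _ _ _) _.
apply: le_trans (ler_sum _ (fun p _ => fg p)) _.
rewrite -rmorph_sum/= lecR.
rewrite -(@fsbig_finite _ _ _ _ _ g) -?fsbig_setD//; last exact: finite_setD.
apply/ltW/(le_lt_trans _ gtN)/(le_trans _ (ler_norm _)).
by rewrite lerD2r (le_trans _ (g_let M))// g_le.
Unshelve. all: by end_near. Qed.

(** The finitely many terms over [G] move to the side of the limit; those outside [D] and [G]
    vanish. *)
Lemma has_sum_restrict (I : choiceType) (D G : set I) (f : I -> C) (s : C) :
  has_sum setT f s -> finite_set G -> D `&` G = set0 ->
  (forall p, ~ D p -> ~ G p -> f p = 0) ->
  has_sum D f (s - \sum_(p \in G) f p).
Proof.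
move=> fs finG DG f0 e /fs[A [finA _] As]; exists (A `&` D).
  by split; [exact: finite_setIl | exact: subIsetr].
move=> F [finF FD] ADF.
(* The set [F] is enlarged until it contains [A]. A point of [A] outside [F] and [G] is not in [D],
   since [F] contains [A] within [D], so its term is zero. *)
have := As (F `|` G `|` A); rewrite -(@fsbig_widen _ _ _ _ (F `|` G)).
- rewrite fsbigU0//=; last by move=> x [/FD Dx Gx]; rewrite -DG.
  rewrite opprB addrA; apply; last by move=> x; right.
  by split => //; rewrite !finite_setU.
- by move=> x; left.
- move=> x [] [//|Ax] nFG /=; apply: f0.
    by move=> Dx; apply: nFG; left; exact: ADF.
  by move=> Gx; apply: nFG; right.
Qed.

Lemma cvg_sumr (K : numFieldType) (I : finType) (f : I -> nat -> K^o) (a : I -> K^o) :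
  (forall i, f i @ \oo --> a i) ->
  (fun N => \sum_i f i N) @ \oo --> \sum_i a i.
Proof. by move=> fa; apply: cvg_big => //; exact: add_continuous. Qed.

(** Over a square of indices the double sum factors into products of two partial exponential sums,
    for the series and for its majorant alike. *)
Lemma has_sum_iexp2 (I : finType) (K : I -> C) (z w : I -> R) :
  has_sum setT
    (fun p => \sum_i K i * (iexp_coeff (z i) p.1 * iexp_coeff (w i) p.2))
    (\sum_i K i * (cis (z i) * cis (w i))).
Proof.
have sumE (V : comPzRingType) (k : I -> V) (u v : I -> nat -> V) N :
    \sum_(l < N) \sum_(j < N) (\sum_i k i * (u i l * v i j)) =
    \sum_i k i * ((\sum_(l < N) u i l) * (\sum_(j < N) v i j)).
  under eq_bigr do rewrite exchange_big.
  rewrite exchange_big; apply: eq_bigr => i _.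
  rewrite big_distrl/= big_distrr/=; apply: eq_bigr => l _.
  by rewrite big_distrr/= big_distrr.
(* The norm on R[i] is complex-valued, so the real majorant takes the real part of each modulus. *)
have ReM (a : C) (u v : R) : 0 <= a ->
    (complex.Re a * (u * v))%:C = a * (u%:C * v%:C).
  by move=> /ger0_real a0; rewrite 2!rmorphM/= RRe_real.
apply: (@has_sum_squares _ (fun p => \sum_i complex.Re `|K i| *
    (exp_coeff `|z i| p.1 * exp_coeff `|w i| p.2)) _
    (\sum_i complex.Re `|K i| * (expR `|z i| * expR `|w i|))).
- move=> p; rewrite (le_trans (ler_norm_sum _ _ _))// rmorph_sum ler_sum// => i _.
  rewrite normrM normrM !norm_iexp_coeff -ReM//; exact: lexx.
- under eq_fun do rewrite (sumE _ K (fun i => iexp_coeff (z i))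
    (fun i => iexp_coeff (w i))).
  by apply: cvg_sumr => i; apply: cvgMl_tmp; apply: cvgM; exact: cvg_iexp.
- under eq_fun do rewrite (sumE _ (fun i => complex.Re `|K i|)
    (fun i => exp_coeff `|z i|) (fun i => exp_coeff `|w i|)).
  apply: cvg_sumr => i; apply: cvgMl_tmp; apply: cvgM.
    by under eq_fun do rewrite -(big_mkord xpredT); exact: is_cvg_series_exp_coeff.
  by under eq_fun do rewrite -(big_mkord xpredT); exact: is_cvg_series_exp_coeff.
Qed.

End Analysis.

(** * Spectral resolutions, nested commutators and matrix exponentials *)

Section Spectral.
Variables (R : realType) (m : nat).
Local Notation C := R[i].
Implicit Types H M : 'M[C]_m.

Lemma adjM (p q r : nat) (A : 'M[C]_(p, q)) (B : 'M[C]_(q, r)) :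
  (A *m B)^t* = B^t* *m A^t*.
Proof. by rewrite trmx_mul map_mxM. Qed.

(** The index runs over a full eigenbasis in the instance built below, so different indices may
    share an eigenvalue. *)
Record resolution H (l : 'I_m -> R) (P : 'I_m -> 'M[C]_m) : Prop := Resolution {
  resolutionE : H = \sum_a (l a)%:C *: P a;
  resolution1 : \sum_a P a = 1%:M;
  resolutionM : forall a b, P a *m P b = (a == b)%:R *: P a;
  resolutionJ : forall a, (P a)^t* = P a }.

(** A real symmetric matrix is Hermitian, so a unitary U diagonalizes it with real eigenvalues; the
    projections are the diagonal matrix units conjugated by U. *)
Lemma spectral_resolution H : H \is symmetricmx -> H \is a realmx ->
  exists l, exists P, resolution H l P.
Proof.
move=> Hs Hr; have Hh := realsym_hermsym Hs Hr.
set U := spectralmx H; have Uu : U \is unitarymx := spectral_unitarymx H.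
have HE : H = U^t* *m diag_mx (spectral_diag H) *m U.
  by rewrite -invmx_unitary//; exact/orthomx_spectralP/hermitian_normalmx.
have UU : U *m U^t* = 1%:M by exact/unitarymxP.
have UU' : U^t* *m U = 1%:M by exact: mulmx1C.
exists (fun a => complex.Re (spectral_diag H 0 a)).
exists (fun a => U^t* *m delta_mx a a *m U); split.
- rewrite {1}HE diag_mx_sum_delta mulmx_sumr mulmx_suml; apply: eq_bigr => a _.
  rewrite RRe_real; last exact/mxOverP/hermitian_spectral_diag_real.
  by rewrite -scalemxAr -scalemxAl.
- by rewrite -mulmx_suml -mulmx_sumr -mx1_sum_delta mulmx1.
- move=> a b; rewrite !mulmxA -(mulmxA _ U) UU mulmx1.
  rewrite -(mulmxA _ _ (delta_mx b b)) mul_delta_mx_cond.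
  by case: eqP => [->|_]; rewrite ?mulr1n ?scale1r// scale0r mulmx0 mul0mx.
- move=> a; rewrite !adjM trmxCK mulmxA; congr (_ *m _ *m _).
  by rewrite trmx_delta map_delta_mx.
Qed.

Variables (H : 'M[C]_m) (l : 'I_m -> R) (P : 'I_m -> 'M[C]_m).
Hypothesis HP : resolution H l P.

Lemma resolution_mulmxl a : H *m P a = (l a)%:C *: P a.
Proof.
rewrite (resolutionE HP) mulmx_suml (bigD1 a)//= big1.
  by rewrite addr0 -scalemxAl (resolutionM HP) eqxx scale1r.
by move=> b /negbTE ba; rewrite -scalemxAl (resolutionM HP) ba scale0r scaler0.
Qed.

Lemma resolution_mulmxr a : P a *m H = (l a)%:C *: P a.
Proof.
rewrite (resolutionE HP) mulmx_sumr (bigD1 a)//= big1.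
  by rewrite addr0 -scalemxAr (resolutionM HP) eqxx scale1r.
move=> b; rewrite eq_sym => /negbTE ab.
by rewrite -scalemxAr (resolutionM HP) ab scale0r scaler0.
Qed.

(** On P_a M P_b, left and right multiplication by H give l_a and l_b, so each commutator
    contributes their difference; k = 0 is the resolution of the identity. *)
Lemma iter_commutator k M :
  iter k (commutator H) M =
  \sum_(p : 'I_m * 'I_m) (l p.1 - l p.2)%:C ^+ k *: (P p.1 *m M *m P p.2).
Proof.
elim: k => [|k IH] /=.
  rewrite -(pair_bigA _ (fun a b => (l a - l b)%:C ^+ 0 *: (P a *m M *m P b)))/=.
  under eq_bigr => a _ do under eq_bigr => b _ do rewrite expr0 scale1r.
  under eq_bigr => a _ do rewrite -mulmx_sumr (resolution1 HP) mulmx1.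
  by rewrite -mulmx_suml (resolution1 HP) mul1mx.
rewrite IH /commutator mulmx_sumr mulmx_suml -sumrB; apply: eq_bigr => p _.
rewrite -scalemxAr -scalemxAl !mulmxA resolution_mulmxl.
rewrite -(mulmxA _ (P p.2)) resolution_mulmxr.
rewrite -!scalemxAl -scalemxAr -scalerBr -scalerBl exprSr -rmorphB/=.
by rewrite scalerA.
Qed.

Lemma expmx_resolution (t : R) :
  expmx (- ('i%C * t%:C) *: H) = \sum_a cis (- (t * l a)) *: P a.
Proof.
have powE (z : C) k : (z *: H) ^+ k = \sum_a (z * (l a)%:C) ^+ k *: P a.
  elim: k => [|k IH].
    under eq_bigr do rewrite expr0 scale1r.
    by rewrite (resolution1 HP).
  rewrite exprS IH -[LHS]/((z *: H) *m _) mulmx_sumr; apply: eq_bigr => a _.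
  by rewrite -scalemxAr -scalemxAl resolution_mulmxl !scalerA exprSr mulrA.
apply/matrixP => i j; rewrite /expmx mxE.
(* Each entry of a partial sum is a fixed finite combination of scalar partial exponential sums, so
   the limit is taken termwise. *)
have -> : (fun N : nat =>
            (\sum_(k < N) (k`!%:R : C)^-1 *: (- ('i%C * t%:C) *: H) ^+ k) i j : C^o) =
    (fun N => \sum_a P a i j * (\sum_(k < N) iexp_coeff (- (t * l a)) k)).
  apply/funext => N; under eq_bigr do rewrite powE scaler_sumr.
  rewrite exchange_big/= summxE; apply: eq_bigr => a _.
  rewrite summxE big_distrr/=; apply: eq_bigr => k _.
  rewrite !mxE /iexp_coeff [RHS]mulrC mulrA [_ / _]mulrC.
  by rewrite rmorphN rmorphM/= mulrN mulNr mulrA.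
rewrite summxE; under [RHS]eq_bigr do rewrite mxE mulrC.
have cv : (fun N => \sum_a P a i j * (\sum_(k < N) iexp_coeff (- (t * l a)) k) : C^o)
    @ \oo --> (\sum_a P a i j * cis (- (t * l a)) : C^o).
  by apply: cvg_sumr => a; apply: cvgMl_tmp; exact: cvg_iexp.
exact: (cvg_lim (@norm_hausdorff _ _) cv).
Qed.

(** The adjoint turns the phases of the left factor into their conjugates, so the two phases combine
    into the difference of eigenvalues. *)
Lemma conj_expmx_resolution (t : R) M :
  (expmx (- ('i%C * t%:C) *: H))^t* *m M *m expmx (- ('i%C * t%:C) *: H) =
  \sum_(p : 'I_m * 'I_m) cis (t * (l p.1 - l p.2)) *: (P p.1 *m M *m P p.2).
Proof.
rewrite -(pair_bigA _ (fun a b => cis (t * (l a - l b)) *: (P a *m M *m P b)))/=.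
rewrite expmx_resolution.
have -> : (\sum_a cis (- (t * l a)) *: P a)^t* = \sum_a cis (t * l a) *: P a.
  rewrite linear_sum/= raddf_sum/=; apply: eq_bigr => a _.
  rewrite linearZ/= map_mxZ (resolutionJ HP) -[LHS]/(_^*%C *: _) conj_cis.
  by rewrite opprK.
rewrite mulmx_suml mulmx_suml; apply: eq_bigr => a _.
rewrite mulmx_sumr; apply: eq_bigr => b _.
by rewrite -!scalemxAl -scalemxAr scalerA -cisD mulrBr.
Qed.

End Spectral.

(** * The double series of nested commutators *)

Lemma iexp_coeffM (R : realType) (g h c d : R) (K : R[i]) (i j : nat) :
  ('i%C * g%:C) ^+ i * ('i%C * h%:C) ^+ j / (i`! * j`!)%:R *
    (K * (c%:C ^+ i * d%:C ^+ j)) =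
  K * (iexp_coeff (g * c) i * iexp_coeff (h * d) j).
Proof.
have iexpE (x y : R) k :
    iexp_coeff (x * y) k = ('i%C * x%:C) ^+ k / k`!%:R * y%:C ^+ k.
  by rewrite /iexp_coeff rmorphM/= mulrA exprMn mulrAC.
rewrite !iexpE natrM invfM mulrCA; congr (_ * _).
by rewrite [X in X * _ = _]mulrACA [LHS]mulrACA.
Qed.

Section DoubleSeries.
Variables (R : realType) (m : nat) (HB HC : 'M[R[i]]_m).
Hypotheses (symB : HB \is symmetricmx) (realB : HB \is a realmx).
Hypotheses (symC : HC \is symmetricmx) (realC : HC \is a realmx).

Lemma has_sum_commutators (A : 'M[R[i]]_m) (psi : 'cV[R[i]]_m) (gamma beta : R) :
  let U := expmx (- ('i%C * beta%:C) *: HB) in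
  let V := expmx (- ('i%C * gamma%:C) *: HC) in
  has_sum setT
    (fun p => ('i%C * gamma%:C) ^+ p.1 * ('i%C * beta%:C) ^+ p.2
              / (p.1`! * p.2`!)%:R
              * (psi^t* *m iter p.1 (commutator HC)
                             (iter p.2 (commutator HB) A) *m psi) 0 0)
    (((U *m (V *m psi))^t* *m A *m (U *m (V *m psi))) 0 0).
Proof.
move=> U V.
have [b [P resB]] := spectral_resolution symB realB.
have [c [Q resC]] := spectral_resolution symC realC.
(* The weight of a quadruple of eigenindices; it depends on neither the angles nor the orders of the
   commutators. *)
pose K (q : ('I_m * 'I_m) * ('I_m * 'I_m)) : R[i] := (psi^t* *m
  (Q q.1.1 *m (P q.2.1 *m A *m P q.2.2) *m Q q.1.2) *m psi) 0 0.
(* One expansion serves twice: with phases for [f] and [g] it gives the evolved expectation, with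
   powers of eigenvalue differences the nested commutators. *)
have sandwich (f g : 'I_m * 'I_m -> R[i]) :
    (psi^t* *m (\sum_p f p *: (Q p.1 *m
      (\sum_q g q *: (P q.1 *m A *m P q.2)) *m Q p.2)) *m psi) 0 0 =
    \sum_q K q * (f q.1 * g q.2).
  rewrite -(pair_bigA _ (fun p q => K (p, q) * (f p * g q)))/=.
  rewrite mulmx_sumr mulmx_suml summxE; apply: eq_bigr => p _.
  rewrite mulmx_sumr mulmx_suml scaler_sumr mulmx_sumr mulmx_suml summxE.
  apply: eq_bigr => q _.
  rewrite -!scalemxAr -!scalemxAl -!scalemxAr -!scalemxAl scalerA mxE.
  by rewrite mulrC.
have -> : ((U *m (V *m psi))^t* *m A *m (U *m (V *m psi))) 0 0 =
    \sum_q K q * (cis (gamma * (c q.1.1 - c q.1.2)) *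
                  cis (beta * (b q.2.1 - b q.2.2))).
  rewrite -(sandwich (fun p => cis (gamma * (c p.1 - c p.2)))
                     (fun p => cis (beta * (b p.1 - b p.2)))).
  (* Conjugation by [U] is the inner one and by [V] the outer one, matching the order of the
     commutators. *)
  rewrite -(conj_expmx_resolution resB) -(conj_expmx_resolution resC).
  rewrite -/U -/V; clearbody U V.
  by rewrite (adjM U) (adjM V) !mulmxA.
have -> : (fun p : nat * nat => ('i%C * gamma%:C) ^+ p.1 * ('i%C * beta%:C) ^+ p.2
              / (p.1`! * p.2`!)%:R
              * (psi^t* *m iter p.1 (commutator HC)
                             (iter p.2 (commutator HB) A) *m psi) 0 0) =
    (fun p => \sum_q K q * (iexp_coeff (gamma * (c q.1.1 - c q.1.2)) p.1 *
                            iexp_coeff (beta * (b q.2.1 - b q.2.2)) p.2)).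
  apply/funext => -[i j] /=.
  rewrite (iter_commutator resB) (iter_commutator resC).
  rewrite (sandwich (fun p => (c p.1 - c p.2)%:C ^+ i)
                    (fun p => (b p.1 - b p.2)%:C ^+ j)) big_distrr/=.
  apply: eq_bigr => q _; exact: iexp_coeffM.
exact: has_sum_iexp2.
Qed.

End DoubleSeries.

(** * Vanishing and transposition of nested commutators *)

Section Commutator.
Variables (R : realType) (m : nat).
Implicit Types A M : 'M[R[i]]_m.

Lemma iter_commutator_comm A M k :
  commutator A M = 0 -> iter k.+1 (commutator A) M = 0.
Proof.
move=> AM; rewrite iterSr AM; elim: k => //= k ->.
by rewrite /commutator mulmx0 mul0mx subr0.
Qed.

(** Transposition reverses products, so each commutator with a symmetric matrix flips the sign. The
    factor [e] lets the lemma be applied first for B and then for C. *)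
Lemma tr_iter_commutator A M (e : R[i]) k : A^T = A -> M^T = e *: M ->
  (iter k (commutator A) M)^T = ((-1) ^+ k * e) *: iter k (commutator A) M.
Proof.
move=> AT MT; elim: k => [|k IH]; first by rewrite expr0 mul1r.
rewrite iterS /commutator linearB/= !trmx_mul AT IH -scalemxAl -scalemxAr.
by rewrite -scalerBr exprS mulN1r mulNr scaleNr -scalerN opprB.
Qed.

End Commutator.

(** * Bit flips, the mixer and the cost Hamiltonian in the computational basis *)

Section Qubits.
Variables (R : realType) (n : nat).
Local Notation C := R[i].
Local Notation ket := (@ket R n).
Local Notation plus := (plus_state R n).
Local Notation mixer := (mixer R n).
Implicit Types (c f g : bits n -> R) (x y : bits n).

Lemma flipK (j : 'I_n) : involutive (fun x : bits n => flip x j).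
Proof.
by move=> x; apply/ffunP => k; rewrite !ffunE; case: eqP => // _; rewrite negbK.
Qed.

Lemma reindex_flip (V : nmodType) (F : bits n -> V) (j : 'I_n) :
  \sum_x F (flip x j) = \sum_x F x.
Proof. by rewrite [RHS](reindex_inj (inv_inj (flipK j))). Qed.

Lemma braE x : (ket x)^t* = delta_mx 0 (enum_rank x).
Proof. by rewrite /Defs.ket trmx_delta map_delta_mx. Qed.

Lemma ket_bra x y :
  ket x *m (ket y)^t* = delta_mx (enum_rank x) (enum_rank y).
Proof. by rewrite braE mul_delta_mx. Qed.

Lemma bra_ket x y : (ket x)^t* *m ket y = (x == y)%:R%:M.
Proof.
rewrite braE mul_delta_mx_cond (inj_eq enum_rank_inj).
by case: (x == y); apply/matrixP => i k; rewrite !ord1 !mxE.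
Qed.

Lemma pauliX_tr (j : 'I_n) : (pauliX R j)^T = pauliX R j.
Proof.
rewrite /pauliX linear_sum/= -[RHS](reindex_flip _ j); apply: eq_bigr => x _.
by rewrite !ket_bra trmx_delta flipK.
Qed.

Lemma mixer_tr : mixer^T = mixer.
Proof. by rewrite linear_sum; apply: eq_bigr => j _; exact: pauliX_tr. Qed.

Lemma proj_tr x : (proj R x)^T = proj R x.
Proof. by rewrite /proj ket_bra trmx_delta. Qed.

Lemma costH_tr c : (costH c)^T = costH c.
Proof.
rewrite linear_sum; apply: eq_bigr => x _.
by rewrite linearZ/= proj_tr.
Qed.

Lemma delta_mx_real (p q : nat) (i : 'I_p) (j : 'I_q) :
  (delta_mx i j : 'M[C]_(p, q)) \is a realmx.
Proof. by apply/mxOverP => k l; rewrite mxE realn. Qed.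

Lemma realmx_sum (I : finType) (p q : nat) (F : I -> 'M[C]_(p, q)) :
  (forall i, F i \is a realmx) -> \sum_i F i \is a realmx.
Proof.
move=> Fr; apply/mxOverP => k l; rewrite summxE.
by apply: sum_real => i _; exact/mxOverP.
Qed.

Lemma mixer_real : mixer \is a realmx.
Proof.
apply: realmx_sum => j; apply: realmx_sum => x.
by rewrite ket_bra delta_mx_real.
Qed.

Lemma costH_real c : costH c \is a realmx.
Proof.
apply: realmx_sum => x; rewrite /proj ket_bra; apply/mxOverP => k l.
by rewrite !mxE realM ?realn//; apply/complex_realP; exists (c x).
Qed.

Lemma tr_symmetricmx (p : nat) (A : 'M[C]_p) : A^T = A -> A \is symmetricmx.
Proof. by move=> AT; apply/is_hermitianmxP; rewrite expr0 scale1r map_mx_id ?AT. Qed.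

Lemma realsym_adj (p : nat) (A : 'M[C]_p) : A^T = A -> A \is a realmx -> A^t* = A.
Proof. by move=> -> Ar; exact: realmxC. Qed.

(** Real amplitude functions stand for states, so B and C become operations on functions: summing
    over neighbours and multiplying by [c]. *)
Definition vec f : 'cV[C]_(dimq n) := \sum_x (f x)%:C *: ket x.

Lemma vecB f g : vec f - vec g = vec (fun x => f x - g x).
Proof.
rewrite /vec -sumrB; apply: eq_bigr => x _.
by rewrite -scalerBl -rmorphB.
Qed.

Lemma vec_tr f : (vec f)^t* = (vec f)^T.
Proof.
rewrite -map_trmx realmxC//; apply: realmx_sum => x; apply/mxOverP => k l.
by rewrite !mxE realM ?realn//; apply/complex_realP; exists (f x).
Qed.

Lemma bra_vec x f : (ket x)^t* *m vec f = (f x)%:C%:M.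
Proof.
rewrite mulmx_sumr (bigD1 x)//= big1 => [|y /negbTE yx].
  by rewrite -scalemxAr bra_ket eqxx addr0 scale_scalar_mx mulr1.
by rewrite -scalemxAr bra_ket eq_sym yx scale_scalar_mx mulr0 raddf0.
Qed.

Lemma dot_vec f g : (vec f)^t* *m vec g = (\sum_x f x * g x)%:C%:M.
Proof.
have -> : (vec f)^t* = \sum_x (f x)%:C *: (ket x)^t*.
  rewrite vec_tr linear_sum; apply: eq_bigr => x _.
  by rewrite linearZ/= braE trmx_delta.
rewrite mulmx_suml rmorph_sum raddf_sum; apply: eq_bigr => x _.
by rewrite -scalemxAl bra_vec scale_scalar_mx -rmorphM.
Qed.

Lemma costH_vec c f : costH c *m vec f = vec (fun x => c x * f x).
Proof.
rewrite mulmx_suml; apply: eq_bigr => x _.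
by rewrite -scalemxAl -mulmxA bra_vec mul_mx_scalar scalerA rmorphM.
Qed.

Lemma mixer_vec f : mixer *m vec f = vec (fun x => \sum_(j < n) f (flip x j)).
Proof.
rewrite mulmx_suml.
under eq_bigr => j _.
  rewrite mulmx_suml -(reindex_flip _ j).
  under eq_bigr => x _ do rewrite -mulmxA bra_vec mul_mx_scalar flipK.
  over.
by rewrite exchange_big; apply: eq_bigr => x _; rewrite rmorph_sum scaler_suml.
Qed.

(** * Expectations in the uniform state *)

Definition amp : R := Num.sqrt 2 ^- n.

Lemma ampM : amp * amp = (2 ^+ n)^-1.
Proof. by rewrite -invfM -expr2 exprAC sqr_sqrtr. Qed.

Lemma plus_vec : plus = vec (fun=> amp).
Proof. by rewrite /plus_state scaler_sumr. Qed.

Lemma mixer_plus : mixer *m plus = n%:R *: plus.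
Proof.
rewrite plus_vec mixer_vec /vec scaler_sumr; apply: eq_bigr => x _.
by rewrite sumr_const card_ord scalerA rmorphMn mulr_natl.
Qed.

Lemma plus_mixer : plus^t* *m mixer = n%:R *: plus^t*.
Proof.
rewrite -{1}(realsym_adj mixer_tr mixer_real) -adjM mixer_plus.
by rewrite linearZ/= map_mxZ rmorph_nat.
Qed.

(** B acts on both the bra and the ket of the uniform state as the scalar n, so the two products
    cancel. *)
Lemma expect0_nabla (M : 'M[C]_(dimq n)) : expect0 (nabla M) = 0.
Proof.
rewrite /expect0 /expect /nabla /commutator mulmxBr mulmxBl !mulmxA plus_mixer.
rewrite -[X in _ - X]mulmxA mixer_plus -!scalemxAl -(scalemxAr _ _ plus) subrr.
by rewrite mxE.
Qed.

Lemma expect0_antisym (M : 'M[C]_(dimq n)) : M^T = - M -> expect0 M = 0.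
Proof.
move=> MT; rewrite /expect0 /expect plus_vec vec_tr; set v := vec _.
(* A 1 by 1 matrix is its own transpose; since the state is real, antisymmetry makes this one equal
   to its negative. *)
have vMv : (v^T *m M *m v)^T = - (v^T *m M *m v).
  by rewrite !trmx_mul trmxK MT mulNmx mulmxN mulmxA.
have /eqP : (v^T *m M *m v) 0 0 = - (v^T *m M *m v) 0 0.
  by move/matrixP/(_ 0 0): vMv; rewrite !mxE.
by rewrite -addr_eq0 -mulr2n mulrn_eq0/= => /eqP.
Qed.

Lemma costH_ket c x : costH c *m ket x = (c x)%:C *: ket x.
Proof.
rewrite mulmx_suml (bigD1 x)//= big1 ?addr0 => [|y /negbTE yx].
  by rewrite -scalemxAl -mulmxA bra_ket eqxx mulmx1.
by rewrite -scalemxAl -mulmxA bra_ket yx raddf0 mulmx0 scaler0.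
Qed.

Lemma costH_proj c x : commutator (costH c) (proj R x) = 0.
Proof.
have CP : costH c *m proj R x = (c x)%:C *: proj R x.
  by rewrite mulmxA costH_ket scalemxAl.
apply/eqP; rewrite subr_eq0; apply/eqP.
(* Both factors are symmetric, so the product in the other order is the transpose of the one just
   computed. *)
rewrite -{2}(costH_tr c) -{2}(proj_tr x) -trmx_mul CP.
by rewrite linearZ/= proj_tr.
Qed.

Lemma costH_costH c : commutator (costH c) (costH c) = 0.
Proof. by rewrite /commutator subrr. Qed.

(** [G] collects the terms displayed on their own and [D] indexes the remaining series; together
    they must cover every index whose term is not forced to vanish. *)
Lemma has_sum_series_term c (gamma beta : R) (A : 'M[C]_(dimq n))
    (D G : set (nat * nat)) :
  A^T = A -> commutator (costH c) A = 0 ->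
  finite_set G -> D `&` G = set0 ->
  (forall p, p = (0, 0)%N \/ [/\ (1 <= p.1)%N, (1 <= p.2)%N & ~~ odd (p.1 + p.2)] ->
     D p \/ G p) ->
  has_sum D (series_term c gamma beta A)
    (expect (qaoa1 c gamma beta) A -
     \sum_(p \in G) series_term c gamma beta A p).
Proof.
move=> AT AC finG DG DGE; apply: has_sum_restrict => //.
  exact: (has_sum_commutators (tr_symmetricmx mixer_tr) mixer_real
    (tr_symmetricmx (costH_tr c)) (costH_real c)).
move=> p nD nG; rewrite /series_term; apply/eqP; rewrite mulf_eq0; apply/orP; right.
apply/eqP; case: p nD nG => l k nD nG /=.
case: l nD nG => [|l] nD nG.
  case: k nD nG => [|k] nD nG /=; last exact: expect0_nabla.
  by have [] := DGE (0, 0)%N (or_introl erefl).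
case: k nD nG => [|k] nD nG.
  by rewrite iter_commutator_comm// /expect0 /expect mulmx0 mul0mx mxE.
(* Both orders are now positive, so an even total would put the index in [D] or [G]. *)
have olk : odd (l.+1 + k.+1).
  apply: contraT => elk.
  by have [] := DGE (l.+1, k.+1) (or_intror (And3 isT isT elk)).
apply: expect0_antisym.
have AT1 : A^T = 1 *: A by rewrite scale1r.
rewrite (tr_iter_commutator _ (costH_tr c) (tr_iter_commutator _ mixer_tr AT1)).
by rewrite mulr1 -exprD -signr_odd olk scaleN1r.
Qed.

(** * Measurement probabilities and the leading coefficient *)

Lemma prob_expect (psi : 'cV[C]_(dimq n)) x : prob psi x = expect psi (proj R x).
Proof.
rewrite /prob /expect /proj mulmxA -[RHS]/((_ *m _ *m _ *m psi) 0 0) -mulmxA.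
have -> : psi^t* *m ket x = ((ket x)^t* *m psi)^t* by rewrite adjM trmxCK.
by rewrite normCK mulrC [RHS]mxE big_ord1 !mxE.
Qed.

Lemma prob_plus x : prob plus x = ((2 ^+ n)^-1 : R)%:C.
Proof.
rewrite /prob plus_vec bra_vec mxE eqxx mulr1n normCK.
by rewrite -[_^*%R]/(_^*%C) conjc_real -rmorphM ampM.
Qed.

(** Summation by parts on the hypercube: the Dirichlet form on the right makes the sign evident. *)
Lemma sum_cost_dcost c :
  \sum_x c x * dcost c x = - (\sum_(j < n) \sum_x (c (flip x j) - c x) ^+ 2) / 2.
Proof.
have -> : \sum_x c x * dcost c x = \sum_(j < n) \sum_x c x * (c (flip x j) - c x).
  by rewrite exchange_big; apply: eq_bigr => x _; rewrite mulr_sumr.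
rewrite mulNr mulr_suml -sumrN; apply: eq_bigr => j _.
apply: (mulIf (_ : 2 != 0)); first by rewrite pnatr_eq0.
(* After doubling, one copy is reindexed by the flip; the two summands then add up to minus a
   square. *)
rewrite mulNr mulfVK ?pnatr_eq0// mulr_natr mulr2n -{2}(reindex_flip _ j).
rewrite -big_split -sumrN; apply: eq_bigr => x _ /=.
by rewrite flipK; ring.
Qed.

(** The double commutator is 2CBC - C^2 B - B C^2. On the uniform state its terms become 2 c d, n
    c^2 and e, and e has the same sum as n c^2 because flips are bijections. *)
Lemma expect0_nablaC_nabla c :
  expect0 (nablaC c (nabla (costH c))) =
  (2 / 2 ^+ n * \sum_x c x * dcost c x)%:C.
Proof.
pose d x := \sum_(j < n) c (flip x j).
pose e x := \sum_(j < n) c (flip x j) ^+ 2.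
have -> : \sum_x c x * dcost c x = \sum_x (c x * d x - n%:R * c x ^+ 2).
  apply: eq_bigr => x _.
  by rewrite /dcost sumrB sumr_const card_ord -mulr_natl -/(d x); ring.
have sum_e : \sum_x e x = \sum_x n%:R * c x ^+ 2.
  rewrite exchange_big/=.
  under eq_bigr => j _ do rewrite (reindex_flip (fun x => c x ^+ 2) j).
  by rewrite sumr_const card_ord -mulr_sumr mulr_natl.
have vecE : nablaC c (nabla (costH c)) *m plus =
    vec (fun x => amp * (2 * (c x * d x) - n%:R * c x ^+ 2 - e x)).
  rewrite /nablaC /nabla /commutator !(mulmxBl, mulmxBr) -!mulmxA plus_vec.
  rewrite !(costH_vec, mixer_vec) !vecB; congr vec; apply/funext => x.
  have -> : \sum_(j < n) c (flip x j) * (c (flip x j) * amp) = e x * amp.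
    by rewrite mulr_suml; apply: eq_bigr => j _; rewrite mulrA.
  by rewrite -mulr_suml -/(d x) sumr_const card_ord -mulr_natl; ring.
rewrite /expect0 /expect -mulmxA vecE plus_vec dot_vec mxE eqxx mulr1n.
congr (_%:C); under eq_bigr do rewrite mulrA ampM.
rewrite -mulr_sumr sumrB sum_e -sumrB (mulrC 2) -mulrA; congr (_ * _).
by rewrite mulr_sumr; apply: eq_bigr => x _; ring.
Qed.

End Qubits.

(** * The expansions of the cost expectation and of the probabilities *)

Theorem theorem3p0p1 (R : realType) (n : nat) (c : bits n -> R)
    (gamma beta : R) :
  [/\ exists2 S : R[i],
        has_sum [set p : nat * nat | [/\ (1 <= p.1)%N, (1 <= p.2)%N,
                                         (4 <= p.1 + p.2)%N
                                       & ~~ odd (p.1 + p.2)]]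
                (series_term c gamma beta (costH c)) S
        & expect (qaoa1 c gamma beta) (costH c)
          = expect0 (costH c)
            - (gamma * beta)%:C * expect0 (nablaC c (nabla (costH c))) + S,
      expect0 (nablaC c (nabla (costH c)))
        = (2 / 2 ^+ n * \sum_(x : bits n) c x * dcost c x)%:C,
      2 / 2 ^+ n * (\sum_(x : bits n) c x * dcost c x) <= 0 :> R
    & forall x : bits n,
        prob (plus_state R n) x = ((2 ^+ n)^-1 : R)%:C
        /\ exists2 S : R[i],
             has_sum [set p : nat * nat | [/\ (1 <= p.1)%N, (1 <= p.2)%N
                                            & ~~ odd (p.1 + p.2)]]
                     (series_term c gamma beta (proj R x)) S
             & prob (qaoa1 c gamma beta) x = prob (plus_state R n) x + S].
Proof.
have term0 A : series_term c gamma beta A (0, 0)%N = expect0 A.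
  by rewrite /series_term/= !expr0 mulr1 divr1 mul1r.
have term1 A : series_term c gamma beta A (1, 1)%N =
    - ((gamma * beta)%:C * expect0 (nablaC c (nabla A))).
  rewrite /series_term/= !expr1 divr1 mulrACA -expr2 sqr_i mulN1r -rmorphM.
  by rewrite mulNr.
split.
(* The orders (0, 0) and (1, 1) give the two explicit terms. *)
- pose G : set (nat * nat) := [set (0, 0)%N] `|` [set (1, 1)%N].
  exists (expect (qaoa1 c gamma beta) (costH c) -
          \sum_(p \in G) series_term c gamma beta (costH c) p).
    apply: has_sum_series_term.
    + exact: costH_tr.
    + exact: costH_costH.
    + by rewrite finite_setU; split; exact: finite_set1.
    + apply/seteqP; split => // p [[p1 p2 p4 _] []] pE.
        by rewrite pE in p1.
      by rewrite pE in p4.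
    + move=> p [->|]; first by right; left.
      (* Two positive orders of even total are either (1, 1) or have total at least 4. *)
      case: p => -[|[|[|l]]] [|[|[|k]]] [] //= _ _ odd_p;
        first [by right; right | by left; split => //=; rewrite ?addnS ?addSn].
  rewrite /G fsbigU0 ?fsbig_set1; first by rewrite term0 term1 addrCA subrr addr0.
  + exact: finite_set1.
  + exact: finite_set1.
  + by move=> p [-> []].
- exact: expect0_nablaC_nabla.
- rewrite sum_cost_dcost mulrA mulrN mulNr oppr_le0.
  rewrite !mulr_ge0 ?invr_ge0 ?exprn_ge0//.
  by apply: sumr_ge0 => j _; apply: sumr_ge0 => x _; exact: sqr_ge0.
- move=> x; split; first exact: prob_plus.
  (* Only order (0, 0) is split off here; it is the initial probability. *)
  exists (expect (qaoa1 c gamma beta) (proj R x) -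
          \sum_(p \in [set (0, 0)%N]) series_term c gamma beta (proj R x) p).
    apply: has_sum_series_term.
    + exact: proj_tr.
    + exact: costH_proj.
    + exact: finite_set1.
    + by apply/seteqP; split => // p [[p1 _ _] pE]; rewrite pE in p1.
    + by move=> p [->|Dp]; [right|left].
  by rewrite fsbig_set1 term0 !prob_expect addrCA subrr addr0.
Qed.
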